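(* Let $\rho:\mathbb{R}_+\to[0,1]$ be a mean field equilibrium. Suppose that for all $t$ in a dense subset $D\subseteq\mathbb{R}_+$, the solution $u:=\rho(t)$ of $u+F_t(r-cu)=1$ is increasing-transversal. Then there exist $n$-player equilibria $(\rho_n)_{n\ge1}$ which Fatou converge in probability to $\rho$ as $n\to\infty$.
   Context: ''Increasing'' means non-decreasing. $(\Omega,\mathcal{G},P)$ is a probability space with a right-continuous filtration $\mathbb{G}=(\mathcal{G}_t)_{t\ge0}$; $r\in\mathbb{R}$ and $c>0$ are constants. A family of c.d.f.s $(F_t)_{t\ge0}$, each continuous in $y$, describes the signals of both games below: $F_t(y)=P\{Y^i_t\le y\}$. $n$-player game. $(Y^i)_{i\ge1}$ are $[0,\infty)$-valued processes which are right-continuous, increasing in $t$, $\mathbb{G}$-progressively measurable, and pairwise i.i.d. with common c.d.f. $F_t$ at time $t$; the $n$-player game has players $1,\dots,n$ with signals $Y^1,\dots,Y^n$. An $n$-player equilibrium is a $\mathbb{G}$-adapted process $\rho_n$ of the form $\rho_n(t)=\#\{j\le n:\tau^j\le t\}/n$, where $\tau^1,\dots,\tau^n$ are $\mathbb{G}$-stopping times with $\tau^i=\inf\{t\ge0:\alpha^i(t)\ge r\}$, $\alpha^i(t)=Y^i_t+c\rho_n^{-i}(t)$, $\rho_n^{-i}(t)=\#\{j\ne i:\tau^j\le t\}/n$. Mean field game. $(I,\mathcal{I},\lambda)$ is an atomless probability space and $(I\times\Omega,\Sigma,\mu)$ is a Fubini extension of $(I\times\Omega,\mathcal{I}\otimes\mathcal{G},\lambda\otimes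 P)$, i.e. a probability space extending the product such that for every $\mu$-integrable $f$ the sections $f(i,\cdot)$ and $f(\cdot,\omega)$ are integrable for a.e. $i$ and a.e. $\omega$, and both iterated integrals exist and equal $\int f\,d\mu$. For each $i\in I$, $Y^i$ is $[0,\infty)$-valued, right-continuous, increasing and $\mathbb{G}$-progressively measurable; for each $t$, $(i,\omega)\mapsto Y^i_t(\omega)$ is $\Sigma$-measurable and $(Y^i_t)_{i\in I}$ are $\lambda$-essentially pairwise i.i.d. with c.d.f. $F_t$ (for $\lambda$-a.e. $i$, $Y^i_t$ is independent of $Y^j_t$ for $\lambda$-a.e. $j$, with common c.d.f. $F_t$). A (deterministic) mean field equilibrium is a function $\rho:\mathbb{R}_+\to[0,1]$ such that $\rho(t)=\lambda\{i:\tau^i\le t\}$ ($P$-a.s.) for all $t\ge0$, where $\tau^i=\inf\{t:\alpha^i(t)\ge r\}$, $\alpha^i(t)=Y^i_t+c\rho(t)$, for $\lambda$-a.e. $i$. Standing assumptions: the times $\tau^i$ are a.s. finite. (They are the minimal optimizers of $\sup_\tau E[e^{r\tau}\mathbf{1}_{\{\theta^i>\tau\}\cup\{\theta^i=\infty\}}]$ over $\mathbb{G}$-stopping times, $\theta^i=\inf\{t:\int_0^t\alpha^i(s)ds=\mathcal{E}\}$ with $\mathcal{E}$ exponential and independent of $\mathbb{G}$; this value is assumed finite.) For fixed $t$, a solution $u\in[0,1]$ of $u+F_t(r-cu)=1$ is increasing-transversal if for all $\varepsilon>0$ there is $u'\in(u-\varepsilon,u)$ with $u'+F_t(r-cu')<1$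 and for all $\varepsilon>0$ there is $u'\in(u,u+\varepsilon)$ with $u'+F_t(r-cu')>1$. A sequence $(\rho_n)$ of $n$-player equilibria Fatou converges in probability to a mean field equilibrium $\rho$ if there is a dense set $D'\subseteq\mathbb{R}_+$ such that $\rho_n(t)\to\rho(t)$ in probability for all $t\in D'$. *)

(* Defs.v *)
From HB Require Import structures.
From mathcomp Require Import all_boot all_order all_algebra.
From mathcomp Require Import all_classical all_reals all_analysis.

Set Implicit Arguments.
Unset Strict Implicit.
Unset Printing Implicit Defensive.

Import Order.TTheory GRing.Theory Num.Theory.
Import numFieldNormedType.Exports.

Local Open Scope classical_set_scope.
Local Open Scope ring_scope.

(* Time runs through R_+.  Processes, filtrations and functions of time are
   indexed by all of R, and every condition on them is restricted to times
   t >= 0, so that their values at negative times are irrelevant. *)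

Section Processes.
Context {d : measure_display} {Omega : measurableType d} {R : realType}.
Implicit Types (P : probability Omega R) (G : R -> set (set Omega))
  (Y alpha : R -> Omega -> R) (tau : Omega -> \bar R).

Record right_continuous_filtration G : Prop := {
  filtration_sigma_algebra : forall t, 0 <= t -> sigma_algebra setT (G t);
  filtration_measurable : forall t, 0 <= t -> G t `<=` measurable;
  filtration_increasing : forall s t, 0 <= s -> s <= t -> G s `<=` G t;
  filtration_right_continuous : forall t, 0 <= t ->
    \bigcap_(s in [set s | t < s]) G s = G t }.

Definition adapted G Y : Prop :=
  forall t, 0 <= t ->
    forall B : set R, measurable B -> G t (Y t @^-1` B).

(* For each t, the restriction of (s, omega) |-> Y s omega to [0, t] x Omega
   is measurable for the product of the Borel sigma-algebra and G t. *)
Definition progressively_measurable G Y : Prop :=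
  forall t, 0 <= t ->
    @measurable_fun _ _ (R * g_sigma_algebraType (G t))%type R
      ([set` `[0, t]] `*` setT) (fun p => Y p.1 p.2).

Record signal_process G Y : Prop := {
  signal_ge0 : forall t w, 0 <= t -> 0 <= Y t w;
  signal_right_continuous : forall t w, 0 <= t ->
    Y s w @[s --> t^'+] --> Y t w;
  signal_increasing : forall s t w, 0 <= s -> s <= t -> Y s w <= Y t w;
  signal_progressive : progressively_measurable G Y }.

Definition stopping_time G tau : Prop :=
  (forall w, (0 <= tau w)%E) /\
  (forall t, 0 <= t -> G t [set w | (tau w <= t%:E)%E]).

(* inf {t >= 0 : alpha t >= r}, equal to +oo if there is no such t. *)
Definition hitting_time (r : R) alpha (w : Omega) : \bar R :=
  ereal_inf [set t%:E | t in [set t | 0 <= t /\ r <= alpha t w]].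

Definition independent P (X Z : Omega -> R) : Prop :=
  forall A B : set R, measurable A -> measurable B ->
    P (X @^-1` A `&` Z @^-1` B) = (P (X @^-1` A) * P (Z @^-1` B))%E.

Definition has_cdf P (X : Omega -> R) (F : R -> R) : Prop :=
  forall y, P [set w | X w <= y] = (F y)%:E.

(* A rate one exponential variable, independent of all the G t.  The law is
   only compared on measurable sets, outside of which it is meaningless. *)
Definition independent_exponential P G (E : Omega -> R) : Prop :=
  [/\ measurable_fun setT E,
      (forall B : set R, measurable B ->
         P (E @^-1` B) = exponential_prob 1 B) &
      (forall t (A : set Omega) (B : set R), 0 <= t -> G t A -> measurable B ->
         P (A `&` E @^-1` B) = (P A * P (E @^-1` B))%E)].

(* inf {t : int_0^t alpha(s) ds = E} *)
Definition default_time alpha (E : Omega -> R) (w : Omega) : \bar R :=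
  ereal_inf [set t%:E | t in [set t | 0 <= t /\
    (\int[lebesgue_measure]_(s in [set` `[0%R, t]]) (alpha s w)%:E)%E
      = (E w)%:E]].

(* e^{r tau} on {theta > tau} U {theta = oo}, and 0 elsewhere. *)
Definition payoff (r : R) (theta tau : Omega -> \bar R) (w : Omega) : \bar R :=
  if (tau w < theta w)%E || (theta w == +oo%E)
  then expeR (r%:E * tau w)%E else 0%E.

Definition stopping_value P G (r : R) (E : Omega -> R) alpha : \bar R :=
  ereal_sup [set (\int[P]_w payoff r (default_time alpha E) tau w)%E
            | tau in stopping_time G].

(* The standing assumptions on an agent with intensity alpha. *)
Definition well_posed P G (r : R) (E : Omega -> R) alpha : Prop :=
  {ae P, forall w, (hitting_time r alpha w < +oo)%E} /\
  (stopping_value P G r E alpha < +oo)%E.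

Definition cvg_in_probability P (X : nat -> Omega -> R) (x : R) : Prop :=
  forall e, 0 < e ->
    P [set w | e <= `|X n w - x|] @[n --> \oo] --> 0%E.

End Processes.

Section DenseAndTransversal.
Context {R : realType}.

Definition dense_in_Rplus (D : set R) : Prop :=
  D `<=` [set t | 0 <= t] /\ [set t | 0 <= t] `<=` closure D.

(* Stated for F = F_t.  When F is continuous, the equation is implied by the
   two crossing conditions. *)
Definition increasing_transversal (r c : R) (F : R -> R) (u : R) : Prop :=
  [/\ 0 <= u <= 1,
      u + F (r - c * u) = 1,
      (forall e, 0 < e -> exists v, u - e < v < u /\ v + F (r - c * v) < 1) &
      (forall e, 0 < e -> exists v, u < v < u + e /\ v + F (r - c * v) > 1)].

End DenseAndTransversal.

Section NPlayerGame.
Context {d : measure_display} {Omega : measurableType d} {R : realType}.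
Variables (P : probability Omega R) (G : R -> set (set Omega)) (r c : R).
Variables (F : R -> R -> R) (Y : nat -> R -> Omega -> R).

(* Players are numbered from 0: in the n-player game, player i : 'I_n has the
   signal Y i.  The i.i.d. requirement concerns the variables Y i t at each
   fixed time t. *)
Record nplayer_signals : Prop := {
  nplayer_signal : forall i, signal_process G (Y i);
  nplayer_independent : forall i j, i != j -> forall t, 0 <= t ->
    independent P (Y i t) (Y j t);
  nplayer_cdf : forall i t, 0 <= t -> has_cdf P (Y i t) (F t) }.

Definition stopped_fraction (n : nat) (tau : 'I_n -> Omega -> \bar R)
    (t : R) (w : Omega) : R :=
  #|[set j : 'I_n | (tau j w <= t%:E)%E]%SET|%:R / n%:R.

Definition others_stopped_fraction (n : nat) (tau : 'I_n -> Omega -> \bar R)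
    (i : 'I_n) (t : R) (w : Omega) : R :=
  #|[set j : 'I_n | (j != i) && (tau j w <= t%:E)%E]%SET|%:R / n%:R.

Definition nplayer_intensity (n : nat) (tau : 'I_n -> Omega -> \bar R)
    (i : 'I_n) (t : R) (w : Omega) : R :=
  Y i t w + c * others_stopped_fraction tau i t w.

Definition nplayer_equilibrium_times (n : nat)
    (tau : 'I_n -> Omega -> \bar R) : Prop :=
  forall i, stopping_time G (tau i) /\
    (forall w, tau i w = hitting_time r (nplayer_intensity tau i) w).

Definition nplayer_equilibrium (n : nat)
    (rho : R -> Omega -> R) : Prop :=
  adapted G rho /\
  exists tau : 'I_n -> Omega -> \bar R,
    nplayer_equilibrium_times tau /\
    (forall t w, 0 <= t -> rho t w = stopped_fraction tau t w).

Definition nplayer_standing_assumptions (E : Omega -> R) : Prop :=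
  forall (n : nat) (tau : 'I_n -> Omega -> \bar R),
    nplayer_equilibrium_times tau ->
    forall i, well_posed P G r E (nplayer_intensity tau i).

End NPlayerGame.

Section MeanFieldGame.
Context {dI dO : measure_display} {I : measurableType dI}.
Context {Omega : measurableType dO} {R : realType}.
Variables (lambda : probability I R) (P : probability Omega R).

Definition atomless : Prop :=
  forall A : set I, measurable A -> (0 < lambda A)%E ->
    exists B : set I, [/\ measurable B, B `<=` A,
      (0 < lambda B)%E & (lambda B < lambda A)%E].

(* The spaces need not be complete, so i |-> int f(i, .) dP is only
   meaningful up to a null set: that the iterated integral exists and equals
   int f dmu means that it does for an integrable version g of this map (and
   symmetrically for h). *)
Record fubini_extension (Sigma : set (set (I * Omega)))
    (mu : probability (g_sigma_algebraType Sigma) R) : Prop := {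
  fubini_sigma_algebra : sigma_algebra setT Sigma;
  fubini_product_sub : (measurable : set (set (I * Omega))) `<=` Sigma;
  fubini_product_eq : forall A : set (I * Omega), measurable A ->
    mu A = (lambda \x P)%E A;
  fubini_sections1 : forall f : I * Omega -> \bar R, mu.-integrable setT f ->
    {ae lambda, forall i, P.-integrable setT (fun w => f (i, w))};
  fubini_sections2 : forall f : I * Omega -> \bar R, mu.-integrable setT f ->
    {ae P, forall w, lambda.-integrable setT (fun i => f (i, w))};
  fubini_iterated1 : forall f : I * Omega -> \bar R, mu.-integrable setT f ->
    exists g : I -> \bar R, [/\ lambda.-integrable setT g,
      {ae lambda, forall i, g i = (\int[P]_w f (i, w))%E} &
      (\int[lambda]_i g i = \int[mu]_p f p)%E];
  fubini_iterated2 : forall f : I * Omega -> \bar R, mu.-integrable setT f ->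
    exists h : Omega -> \bar R, [/\ P.-integrable setT h,
      {ae P, forall w, h w = (\int[lambda]_i f (i, w))%E} &
      (\int[P]_w h w = \int[mu]_p f p)%E] }.

Variables (G : R -> set (set Omega)) (r c : R) (F : R -> R -> R).
Variable (Y : I -> R -> Omega -> R).

Record mfg_signals (Sigma : set (set (I * Omega))) : Prop := {
  mfg_signal : forall i, signal_process G (Y i);
  mfg_jointly_measurable : forall t, 0 <= t ->
    @measurable_fun _ _ (g_sigma_algebraType Sigma) R setT
      (fun p => Y p.1 t p.2);
  mfg_independent : forall t, 0 <= t ->
    {ae lambda, forall i, {ae lambda, forall j,
      independent P (Y i t) (Y j t)}};
  mfg_cdf : forall t, 0 <= t ->
    {ae lambda, forall i, has_cdf P (Y i t) (F t)} }.

Definition mfg_intensity (rho : R -> R) (i : I) (t : R) (w : Omega) : R :=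
  Y i t w + c * rho t.

(* Measurability of {i : tau^i <= t}, implicit in lambda {i : tau^i <= t}, is
   part of the definition since lambda is total on set I. *)
Definition mean_field_equilibrium (rho : R -> R) : Prop :=
  (forall t, 0 <= t -> 0 <= rho t <= 1) /\
  exists tau : I -> Omega -> \bar R,
    {ae lambda, forall i, forall w,
       tau i w = hitting_time r (mfg_intensity rho i) w} /\
    (forall t, 0 <= t -> {ae P, forall w,
       measurable [set i | (tau i w <= t%:E)%E] /\
       lambda [set i | (tau i w <= t%:E)%E] = (rho t)%:E}).

Definition mfg_standing_assumptions (E : Omega -> R) (rho : R -> R) : Prop :=
  {ae lambda, forall i, well_posed P G r E (mfg_intensity rho i)}.

End MeanFieldGame.

Section FatouConvergence.
Context {d : measure_display} {Omega : measurableType d} {R : realType}.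

Definition fatou_cvg_in_probability (P : probability Omega R)
    (rho_ : nat -> R -> Omega -> R) (rho : R -> R) : Prop :=
  exists D' : set R, dense_in_Rplus D' /\
    (forall t, D' t -> cvg_in_probability P (fun n => rho_ n t) (rho t)).

End FatouConvergence.

(* Main.v *)
Require Import Defs.
From mathcomp Require Import all_boot all_order all_algebra.
From mathcomp Require Import all_classical all_reals all_analysis.
From mathcomp Require Import measurable_realfun.
From mathcomp Require Import ring lra.
Import Order.TTheory GRing.Theory Num.Theory.
Import numFieldNormedType.Exports.
Local Open Scope classical_set_scope.
Local Open Scope ring_scope.

(** In the n-player game, the set of players stopped by time t must be a fixed
    point of the best reply map S |-> {i : Y^i_t + c #(S minus i)/n >= r}, which
    is increasing in S and in t; conversely, any adapted, increasing,
    right-continuous family of fixed points is an equilibrium.  The game may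
    have many fixed points, and the least one can stay far below the mean field
    value rho(t).  The equilibria constructed here are therefore pushed up at
    finitely many dates.

    A push (s, v) looks at the set K of players with Y^i_s >= r - c v.  If K has
    at least v n + 1 members, then each of them, seeing the others in K stopped,
    wants to stop as well: K lies below its own best reply ([keen_stable]), and
    this remains so at all dates after s.  The stopped set at time t is the least
    solution of S = K_1 U ... U K_m U best reply(S), where the K_j come from the
    successful pushes up to t.  It is a fixed point of the best reply map
    ([stopped_fixed]), it inherits adaptedness, monotonicity and right-continuity
    from the signals, so it defines an equilibrium ([pushed_equilibrium]), and
    after a successful push at level v it contains at least a share v of the
    players ([stopped_ge]).  On the other hand, if a level h above all pushed
    levels satisfies #{i : Y^i_t >= r - c h} <= h n, then this set is closed
    under best replies and caps the stopped set at the share h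
    ([stopped_le_level]).

    By the weak law of large numbers for pairwise independent events,
    #{i : Y^i_t >= r - c v}/n tends to 1 - F_t(r - c v).  Transversality at rho(t)
    gives v < rho(t) and h > rho(t), both as close to rho(t) as desired, with
    v < 1 - F_t(r - c v) and 1 - F_t(r - c h) < h; so a push at (t, v) succeeds and
    h is a cap, both with probability tending to one ([keen_count_low],
    [keen_count_high]).  Earlier pushes do not break the cap, because rho is
    increasing.  Let (t_k) be a sequence in D that is dense in the half-line, and
    v_{k,m} an admissible level within 1/(m+1) of rho(t_k).  The n-player
    equilibrium uses the pushes (t_k, v_{k,m}) with k, m < n; hence each of them is
    present for all large n, and rho_n(t_k) tends to rho(t_k) for every k. *)

(** * The weak law of large numbers for pairwise independent events *)

Section WeakLaw.
Context {d : measure_display} {T : measurableType d} {R : realType}.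
Variable P : probability T R.

Definition occurrences (b : nat -> pred T) (n : nat) (w : T) : R :=
  \sum_(i < n) (b i w)%:R.

Lemma measurable_indicator (b : pred T) :
  measurable [set w | b w] -> measurable_fun setT (fun w => (b w)%:R : R).
Proof.
move=> mb; rewrite (_ : (fun w => _) = \1_[set w | b w]).
  exact: measurable_indic.
by apply/funext => w; rewrite indicE mem_setE.
Qed.

Lemma integral_indicator (b : pred T) : measurable [set w | b w] ->
  (\int[P]_w ((b w)%:R : R)%:E = P [set w | b w])%E.
Proof.
move=> mb; rewrite -[in RHS](setIT [set w | b w]) -(integral_indic P measurableT mb).
by apply: eq_integral => w _; rewrite indicE mem_setE.
Qed.

Lemma measurable_occurrences (b : nat -> pred T) n :
  (forall i, measurable [set w | b i w]) ->
  measurable_fun setT (occurrences b n).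
Proof.
by move=> mb; apply: measurable_sum => i; apply: measurable_indicator.
Qed.

Lemma integral_occurrences (b : nat -> pred T) (q : R) n :
  (forall i, measurable [set w | b i w]) ->
  (forall i, P [set w | b i w] = q%:E) ->
  (\int[P]_w (occurrences b n w)%:E = (q *+ n)%:E)%E.
Proof.
move=> mb Pb; under eq_integral do rewrite -sumEFin.
rewrite ge0_integral_sum//; last first.
  by move=> i; apply/measurable_EFinP/measurable_indicator.
under eq_bigr do rewrite integral_indicator// Pb.
by rewrite sumEFin sumr_const card_ord.
Qed.

(** Squaring the sum leaves n diagonal terms of mass q and n(n-1) pairs of mass
    q^2: pairwise independence is all that the second moment sees. *)
Lemma integral_sqr_occurrences (b : nat -> pred T) (q : R) n :
  (forall i, measurable [set w | b i w]) ->
  (forall i, P [set w | b i w] = q%:E) ->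
  (forall i j, i != j ->
    P ([set w | b i w] `&` [set w | b j w]) = (q * q)%:E) ->
  (\int[P]_w (occurrences b n w ^+ 2)%:E =
    (n%:R * q + n%:R * (n%:R - 1) * q ^+ 2)%:E)%E.
Proof.
move=> mb Pb Pbb.
have E (w : T) : (occurrences b n w ^+ 2)%:E =
    (\sum_(i < n) \sum_(j < n) ((b i w && b j w)%:R : R)%:E)%E.
  rewrite expr2 /occurrences mulr_suml -sumEFin; apply: eq_bigr => i _.
  rewrite mulr_sumr -sumEFin; apply: eq_bigr => j _.
  by case: (b i w); case: (b j w); rewrite ?mulr1 ?mulr0.
have mbb i j : measurable [set w | b i w && b j w].
  rewrite (_ : [set w | _] = [set w | b i w] `&` [set w | b j w]).
    exact: measurableI.
  by apply/seteqP; split=> w /= => [/andP|[-> ->]].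
under eq_integral do rewrite E.
rewrite ge0_integral_sum//; last 2 first.
- move=> i; apply: emeasurable_sum => j.
  exact/measurable_EFinP/measurable_indicator/mbb.
- by move=> i w _; apply: sume_ge0.
have Ei (i : 'I_n) :
    (\int[P]_w \sum_(j < n) ((b i w && b j w)%:R : R)%:E =
     (q + (n%:R - 1) * q ^+ 2)%:E)%E.
  rewrite ge0_integral_sum//; last first.
    by move=> j; exact/measurable_EFinP/measurable_indicator/mbb.
  under eq_bigr do rewrite integral_indicator//.
  have n0 : (0 < n)%N by apply: leq_ltn_trans (ltn_ord i).
  rewrite (bigD1 i)//= EFinD; congr (_ + _)%E.
    rewrite -(Pb i); congr (P _).
    by apply/seteqP; split=> w /=; rewrite andbb.
  rewrite (eq_bigr (fun=> (q * q)%:E)); last first.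
    move=> j ji; rewrite -(Pbb i j) 1?eq_sym//; congr (P _).
    by apply/seteqP; split=> w /= => [/andP|[-> ->]].
  rewrite sumEFin sumr_const; congr (_%:E).
  rewrite cardC1 card_ord -[LHS]mulr_natl expr2; congr (_ * _).
  by rewrite -[in RHS](prednK n0) -[X in _ = X - 1]natr1 addrK.
under eq_bigr do rewrite Ei.
rewrite sumEFin sumr_const card_ord; congr (_%:E); rewrite -[LHS]mulr_natl; ring.
Qed.

Lemma occurrences_variance (b : nat -> pred T) (q : R) n :
  (forall i, measurable [set w | b i w]) ->
  (forall i, P [set w | b i w] = q%:E) ->
  (forall i j, i != j ->
    P ([set w | b i w] `&` [set w | b j w]) = (q * q)%:E) ->
  (\int[P]_w ((occurrences b n w - n%:R * q) ^+ 2)%:E =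
    (n%:R * (q * (1 - q)))%:E)%E.
Proof.
move=> mb Pb Pbb.
have q0 : 0 <= q by rewrite -lee_fin -(Pb 0%N).
have N0 w : 0 <= occurrences b n w by apply: sumr_ge0.
have mN := measurable_occurrences b n mb.
have k0 : 0 <= 2 * n%:R * q by rewrite !mulr_ge0.
(* Moving the cross term to the left-hand side makes all integrands
   nonnegative. *)
have : (\int[P]_w ((occurrences b n w - n%:R * q) ^+ 2)%:E +
    \int[P]_w (2 * n%:R * q * occurrences b n w)%:E =
    \int[P]_w (occurrences b n w ^+ 2)%:E +
    \int[P]_w (n%:R ^+ 2 * q ^+ 2)%:E)%E.
  rewrite -!ge0_integralD//=.
  - apply: eq_integral => w _; rewrite -!EFinD; congr (_%:E); ring.
  - by move=> w _; rewrite lee_fin sqr_ge0.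
  - by apply/measurable_EFinP; apply: measurable_funX.
  - by move=> w _; rewrite lee_fin mulr_ge0// sqr_ge0.
  - by move=> w _; rewrite lee_fin sqr_ge0.
  - apply/measurable_EFinP; apply: measurable_funX.
    by apply: measurable_funB.
  - by move=> w _; rewrite lee_fin mulr_ge0.
  - by apply/measurable_EFinP; apply: measurable_funM.
rewrite (integral_sqr_occurrences b q n mb Pb Pbb).
under [X in (_ + X = _)%E]eq_integral do rewrite EFinM.
rewrite ge0_integralZl//; last 2 first.
- exact/measurable_EFinP.
- by move=> w _; rewrite lee_fin.
have -> : (\int[P]_w (n%:R ^+ 2 * q ^+ 2)%:E = (n%:R ^+ 2 * q ^+ 2)%:E)%E.
  by have := expectation_cst P (n%:R ^+ 2 * q ^+ 2); rewrite unlock.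
rewrite (integral_occurrences b q n mb Pb) -EFinM -EFinD.
case: (\int[P]_w _)%E => [x| |] //= [] e.
congr (_%:E); move: e; rewrite -mulr_natl => e; lra.
Qed.

(** Chebyshev's inequality, with the variance of one indicator at most 1. *)
Lemma weak_law_bound (b : nat -> pred T) (q e : R) n :
  (forall i, measurable [set w | b i w]) ->
  (forall i, P [set w | b i w] = q%:E) ->
  (forall i j, i != j ->
    P ([set w | b i w] `&` [set w | b j w]) = (q * q)%:E) ->
  0 < e -> (0 < n)%N ->
  (P [set w | (e * n%:R <= `|occurrences b n w - n%:R * q|)%R] <=
    (e ^- 2 * n%:R^-1)%:E)%E.
Proof.
move=> mb Pb Pbb e0 n0.
have n0' : 0 < n%:R :> R by rewrite ltr0n.
have q0 : 0 <= q by rewrite -lee_fin -(Pb 0%N).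
have q1 : q <= 1 by rewrite -lee_fin -(Pb 0%N) probability_le1.
set B := [set w | _].
have mD : measurable_fun setT (fun w => occurrences b n w - n%:R * q).
  by apply: measurable_funB => //; exact: measurable_occurrences.
have mB : measurable B.
  rewrite -[B]setTI; apply: measurable_fun_le => //.
  exact: measurableT_comp.
have H : (((e * n%:R) ^+ 2)%:E * P B <= (n%:R * (q * (1 - q)))%:E)%E.
  rewrite -(occurrences_variance b q n mb Pb Pbb) -integral_cst//.
  apply: (@le_trans _ _
    (\int[P]_(w in B) ((occurrences b n w - n%:R * q) ^+ 2)%:E)%E).
    apply: ge0_le_integral => //=.
    - by move=> w _; rewrite lee_fin sqr_ge0.
    - apply/measurable_EFinP; apply: measurable_funX.
      exact: measurable_funS mD.
    - move=> w Bw; rewrite lee_fin -[leRHS]real_normK ?num_real//.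
      by rewrite ler_pXn2r// nnegrE mulr_ge0// ltW.
  apply: ge0_subset_integral => //.
  - by apply/measurable_EFinP; apply: measurable_funX.
  - by move=> w _; rewrite lee_fin sqr_ge0.
have en0 : 0 < (e * n%:R) ^+ 2 by rewrite exprn_gt0// mulr_gt0.
rewrite -lee_pdivlMl// -EFinM in H; apply: (le_trans H); rewrite lee_fin.
have -> : e ^- 2 / n%:R = ((e * n%:R) ^+ 2)^-1 * n%:R.
  by field; rewrite !gt_eqF.
rewrite ler_pM2l ?invr_gt0//; apply: ler_piMr; first exact: ltW.
nra.
Qed.

Lemma weak_law (b : nat -> pred T) (q e : R) :
  (forall i, measurable [set w | b i w]) ->
  (forall i, P [set w | b i w] = q%:E) ->
  (forall i j, i != j ->
    P ([set w | b i w] `&` [set w | b j w]) = (q * q)%:E) ->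
  0 < e ->
  P [set w | e * n%:R <= `|occurrences b n w - n%:R * q|] @[n --> \oo] --> 0%E.
Proof.
move=> mb Pb Pbb e0.
apply: (@squeeze_cvge _ _ _ _ (cst 0%E) _
  (fun n => (e ^- 2 * n%:R^-1)%:E)).
- near=> n; rewrite measure_ge0/=; apply: weak_law_bound => //.
  by near: n; exact: nbhs_infty_gt.
- exact: cvg_cst.
- apply: cvg_EFin; first by near=> n.
  rewrite /comp/= -[X in _ --> X](mulr0 (e ^- 2)); apply: cvgMr.
  by rewrite -(@cvg_shiftS R); exact: cvg_harmonic.
Unshelve. all: by end_near. Qed.
End WeakLaw.

(** * Best replies and their fixed points at one date *)

Section StaticGame.
Context {R : realType} {n : nat}.
Variables (r c : R).
Hypothesis c_gt0 : 0 < c.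
Implicit Types (y : 'I_n -> R) (S X : {set 'I_n}) (u : R).

Definition others S (i : 'I_n) : R :=
  #|[set j : 'I_n | (j != i) && (j \in S)]%SET|%:R / n%:R.

Definition best_reply y S : {set 'I_n} :=
  [set i | r <= y i + c * others S i]%SET.

(** The least S containing X and its own best reply.  When X lies below its own
    best reply, this is the least fixed point of [best_reply y] above X: the
    choice of X selects among the fixed points. *)
Definition settled y X : {set 'I_n} :=
  fixset (fun S => X :|: best_reply y S)%SET.

(** The best reply when the stopped share is u, whoever the stopped players are.
    Unlike in [best_reply], membership of i depends on the signal of i alone, so
    that the law of large numbers applies to the size of this set. *)
Definition keen u y : {set 'I_n} := [set i | r <= y i + c * u]%SET.

Lemma others_le S S' i : S \subset S' -> others S i <= others S' i.
Proof.
move=> SS'; rewrite ler_wpM2r ?invr_ge0// ler_nat; apply: fintype.subset_leq_card.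
by apply/fintype.subsetP => j; rewrite !inE => /andP[-> /(fintype.subsetP SS')].
Qed.

Lemma best_replyS y y' S S' : (forall i, y i <= y' i) -> S \subset S' ->
  best_reply y S \subset best_reply y' S'.
Proof.
move=> yy' SS'; apply/fintype.subsetP => i; rewrite !inE => /le_trans; apply.
by rewrite lerD// ler_pM2l// others_le.
Qed.

Lemma keenS u u' y y' : u <= u' -> (forall i, y i <= y' i) ->
  keen u y \subset keen u' y'.
Proof.
move=> uu' yy'; apply/fintype.subsetP => i; rewrite !inE => /le_trans; apply.
by rewrite lerD// ler_pM2l.
Qed.

(** The extra player in the hypothesis makes up for the fact that a player does
    not count itself among the stopped ones. *)
Lemma keen_stable u y : u * n%:R + 1 <= #|keen u y|%:R ->
  keen u y \subset best_reply y (keen u y).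
Proof.
move=> ku; apply/fintype.subsetP => i ik; rewrite inE.
have n0 : (0 < n)%N by apply: leq_ltn_trans (ltn_ord i).
move: (ik); rewrite inE => /le_trans; apply.
rewrite lerD2l ler_pM2l// /others ler_pdivlMr ?ltr0n//.
rewrite (_ : [set j | _]%SET = keen u y :\ i)%SET; last first.
  by apply/finset.setP => j; rewrite !inE.
by rewrite -(lerD2r 1) natr1; have := cardsD1 i (keen u y); rewrite ik add1n => <-.
Qed.

(** A player who stops in response to at most a share u of stopped players would
    stop in response to u itself. *)
Lemma keen_closed u y : #|keen u y|%:R <= u * n%:R ->
  best_reply y (keen u y) \subset keen u y.
Proof.
move=> ku; apply/fintype.subsetP => i; rewrite inE => ri; rewrite inE.
have n0 : (0 < n)%N by apply: leq_ltn_trans (ltn_ord i).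
apply: (le_trans ri); rewrite lerD2l ler_pM2l// /others ler_pdivrMr ?ltr0n//.
apply: le_trans ku; rewrite ler_nat; apply: fintype.subset_leq_card.
by apply/fintype.subsetP => j; rewrite inE => /andP[].
Qed.

Lemma settled_eq y X : settled y X = (X :|: best_reply y (settled y X))%SET.
Proof.
rewrite [LHS]/settled -fixsetK// => S S' SS'.
by apply: finset.setUS; apply: best_replyS.
Qed.

Lemma settled_min y X S : X \subset S -> best_reply y S \subset S ->
  settled y X \subset S.
Proof.
move=> XS rS; rewrite /settled/fixset.
elim: #|_| => [|m IH] /=; first exact: finset.sub0set.
rewrite finset.subUset XS/=; apply: fintype.subset_trans rS.
exact: best_replyS.
Qed.

Lemma sub_settled y X : X \subset settled y X.
Proof. by rewrite settled_eq finset.subsetUl. Qed.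

(** When X already lies below its best reply, it can be dropped from the equation
    S = X U best_reply y S, since X is below the best reply to any S above X. *)
Lemma settled_fixed y X : X \subset best_reply y X ->
  best_reply y (settled y X) = settled y X.
Proof.
move=> Xr; apply/eqP; rewrite finset.eqEsubset; apply/andP; split.
  by rewrite {2}settled_eq finset.subsetUr.
rewrite {1}settled_eq finset.subUset subxx andbT.
by apply: (fintype.subset_trans Xr); apply: best_replyS (sub_settled y X).
Qed.

Lemma settledS y y' X X' : (forall i, y i <= y' i) -> X \subset X' ->
  settled y X \subset settled y' X'.
Proof.
move=> yy' XX'; apply: settled_min.
  exact: fintype.subset_trans XX' (sub_settled y' X').
apply: (fintype.subset_trans (B := mem (best_reply y' (settled y' X')))).
  exact: best_replyS.
by rewrite {2}settled_eq finset.subsetUr.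
Qed.

Lemma eq_settled y y' X : best_reply y =1 best_reply y' ->
  settled y X = settled y' X.
Proof. by move=> /funext e; rewrite /settled e. Qed.

End StaticGame.

(** * Evolution of the stopped set under finitely many pushes *)

Section PushedEvolution.
Context {R : realType} {n : nat} {J : finType}.
Variables (r c : R).
Hypothesis c_gt0 : 0 < c.
Variables (s v : J -> R).
Hypothesis s_ge0 : forall j, 0 <= s j.

(** A push is carried out only if it is self-sustaining ([keen_stable]); this is
    known at its date [s j], so that pushing remains adapted. *)
Definition pushing (y : R -> 'I_n -> R) t j :=
  (s j <= t) && (v j * n%:R + 1 <= #|keen r c (v j) (y (s j))|%:R).

Definition pushed (y : R -> 'I_n -> R) t : {set 'I_n} :=
  [set i | [exists j, pushing y t j && (i \in keen r c (v j) (y (s j)))]]%SET.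

Definition stopped (y : R -> 'I_n -> R) t : {set 'I_n} :=
  settled r c (y t) (pushed y t).

(** The stopped set is a function of finitely many comparisons between signals
    and constants.  Used between two dates, this gives right-continuity; between
    two scenarios, measurability. *)
Lemma eq_stopped (y y' : R -> 'I_n -> R) t t' :
  best_reply r c (y t) =1 best_reply r c (y' t') ->
  (forall j, (s j <= t) = (s j <= t')) ->
  (forall j, s j <= t -> keen r c (v j) (y (s j)) = keen r c (v j) (y' (s j))) ->
  stopped y t = stopped y' t'.
Proof.
move=> er es ek; rewrite /stopped (eq_settled _ _ _ _ _ er); congr settled.
apply/finset.setP => i; rewrite !inE; apply: eq_existsb => j; rewrite /pushing -es.
by have [/ek ->//|//] := boolP (s j <= t).
Qed.

Section Path.
Variable y : R -> 'I_n -> R.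
Hypothesis y_le : forall a b i, 0 <= a -> a <= b -> y a i <= y b i.

Lemma pushed_le a b : a <= b -> pushed y a \subset pushed y b.
Proof.
move=> ab; apply/fintype.subsetP => i; rewrite !inE => /existsP[j].
rewrite -andbA => /and3P[sa pj ij]; apply/existsP; exists j.
by rewrite /pushing (le_trans sa ab) pj.
Qed.

Lemma stopped_le a b : 0 <= a -> a <= b -> stopped y a \subset stopped y b.
Proof.
move=> a0 ab; apply: settledS => //; first by move=> i; apply: y_le.
exact: pushed_le.
Qed.

(** Signals have only grown since a push, so the pushed players, who were willing
    to stop together then, still are. *)
Lemma stopped_fixed t : best_reply r c (y t) (stopped y t) = stopped y t.
Proof.
apply: settled_fixed => //; apply/fintype.subsetP => i.
rewrite {1}inE => /existsP[j /andP[pj ij]].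
have /andP[st vj] := pj.
have := fintype.subsetP (keen_stable _ _ c_gt0 _ _ vj) i ij.
apply/fintype.subsetP/best_replyS => //; first by move=> k; apply: y_le.
by apply/fintype.subsetP => k kj; rewrite inE; apply/existsP; exists j; rewrite pj.
Qed.

Lemma stopped_ge t j : (0 < n)%N -> pushing y t j ->
  v j <= #|stopped y t|%:R / n%:R.
Proof.
move=> n0 pj; have /andP[st vj] := pj; rewrite ler_pdivlMr ?ltr0n//.
apply: (@le_trans _ _ #|keen r c (v j) (y (s j))|%:R).
  by apply: le_trans vj; rewrite lerDl.
rewrite ler_nat; apply/fintype.subset_leq_card.
apply: fintype.subset_trans (sub_settled _ _ c_gt0 _ _).
by apply/fintype.subsetP => k kj; rewrite inE; apply/existsP; exists j; rewrite pj.
Qed.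

(** A level that closes itself under best replies at t caps the stopped set, as
    soon as it dominates the levels of the pushes made so far. *)
Lemma stopped_le_level t u : (0 < n)%N -> (forall j, s j <= t -> v j <= u) ->
  #|keen r c u (y t)|%:R <= u * n%:R -> #|stopped y t|%:R / n%:R <= u.
Proof.
move=> n0 vu ku; rewrite ler_pdivrMr ?ltr0n//; apply: (le_trans _ ku).
rewrite ler_nat; apply: fintype.subset_leq_card.
apply: settled_min => //; last exact: keen_closed.
apply/fintype.subsetP => i; rewrite {1}inE => /existsP[j /andP[/andP[st _]]].
by apply/fintype.subsetP/keenS => //; [exact: vu|move=> k; exact: y_le].
Qed.

(** Each of the finitely many comparisons deciding [stopped y a] is constant on
    some interval [t, t + e): those that hold at t persist because signals
    increase, and those that fail at t are strict inequalities. *)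
Lemma stopped_right_continuous t : 0 <= t ->
  (forall i, y a i @[a --> t^'+] --> y t i) ->
  \forall a \near t^'+, stopped y a = stopped y t.
Proof.
move=> t0 yt.
(* Indexing by all sets S makes the family of comparisons finite. *)
have nr : \forall a \near t^'+, forall p : 'I_n * {set 'I_n},
    (p.1 \in best_reply r c (y a) p.2) = (p.1 \in best_reply r c (y t) p.2).
  apply: filter_forall => -[i S] /=; rewrite inE.
  have [ri|ri] := leP r.
    near=> a; rewrite inE; apply: (le_trans ri); rewrite lerD2r.
    by apply: y_le => //; apply: ltW; near: a; exact: nbhs_right_gt.
  rewrite -ltrBrDr in ri.
  near=> a; rewrite inE; apply/negbTE; rewrite -ltNge -ltrBrDr.
  near: a; exact: (cvgr_lt _ (yt i)).
have ns : \forall a \near t^'+, forall j, (s j <= a) = (s j <= t).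
  apply: filter_forall => j; have [st|ts] := leP (s j) t.
    near=> a; apply: (le_trans st); apply: ltW; near: a; exact: nbhs_right_gt.
  near=> a; apply/negbTE; rewrite -ltNge; near: a; exact: nbhs_right_lt.
near=> a; apply: eq_stopped => //.
- move=> S; apply/finset.setP => i.
  by have /(_ (i, S)) : forall p : 'I_n * {set 'I_n},
    (p.1 \in best_reply r c (y a) p.2) = (p.1 \in best_reply r c (y t) p.2)
    by near: a.
- by near: a.
Unshelve. all: by end_near. Qed.

End Path.
End PushedEvolution.

(** * Measurability from finitely many events *)

Section FiniteInformation.
Context {d : measure_display} {T : measurableType d}.

(** B is the union of those atoms of the finite algebra generated by the events
    b_k that meet it. *)
Lemma finite_information (S : set (set T)) (K : finType) (b : K -> pred T)
    (B : set T) :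
  sigma_algebra setT S -> (forall k, S [set w | b k w]) ->
  (forall w w', (forall k, b k w = b k w') -> B w -> B w') -> S B.
Proof.
move=> sS Sb bB.
have mS A : S A = @measurable _ (g_sigma_algebraType S) A.
  by rewrite /measurable/= sigma_algebra_id.
have -> : B = \bigcup_(f in [set f : {ffun K -> bool} |
    exists2 w, B w & forall k, b k w = f k])
    \bigcap_(k in setT) [set w | b k w = f k].
  apply/seteqP; split=> [w Bw|w [f [w' Bw' bf] /= bw]].
    exists [ffun k => b k w]; last by move=> k _ /=; rewrite ffunE.
    by exists w => // k; rewrite ffunE.
  by apply: bB Bw' => k; rewrite bf -bw.
rewrite mS; apply: fin_bigcup_measurable; first exact: finite_finset.
move=> f _; apply: fin_bigcap_measurable; first exact: finite_finset.
move=> k _; case: (f k); first by have := Sb k; rewrite mS.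
rewrite (_ : [set w | _] = ~` [set w | b k w]).
  by apply: measurableC; have := Sb k; rewrite mS.
by apply/seteqP; split=> w /= => [->//|/negP/negbTE].
Qed.

End FiniteInformation.

(** The section at the last date t of the restriction to [0, t] x Omega. *)
Lemma progressively_measurable_adapted {d} {Omega : measurableType d}
    {R : realType} (G : R -> set (set Omega)) (Y : R -> Omega -> R) :
  right_continuous_filtration G -> progressively_measurable G Y -> adapted G Y.
Proof.
move=> hG pY t t0 B mB.
have mR : measurable ([set` `[0, t]] : set R) by exact: measurable_itv.
have mD : @measurable _ (R * g_sigma_algebraType (G t))%type
    ([set` `[0, t]] `*` setT) by apply: measurableX.
have := @measurable_xsection _ _ _ (g_sigma_algebraType (G t)) _ t (pY t t0 mD B mB).
rewrite /measurable/= sigma_algebra_id; last exact: (filtration_sigma_algebra hG).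
congr (G t _); apply/seteqP; split=> w; rewrite /xsection/= in_setE/=.
  by case.
by rewrite in_itv/= t0 lexx.
Qed.

(** * The pushed equilibria of the n-player game *)

Section PushedEquilibrium.
Context {d : measure_display} {Omega : measurableType d} {R : realType}.
Variables (G : R -> set (set Omega)) (r c : R).
Hypothesis hG : right_continuous_filtration G.
Hypothesis c_gt0 : 0 < c.
Variable (Y : nat -> R -> Omega -> R).
Hypothesis Y_signal : forall i, signal_process G (Y i).
Variables (n : nat) (J : finType) (s v : J -> R).
Hypothesis s_ge0 : forall j, 0 <= s j.

Definition signal_path (w : Omega) (t : R) (i : 'I_n) : R := Y i t w.

Let stop w t := stopped r c s v (signal_path w) t.

Definition stopped_share (t : R) (w : Omega) : R := #|stop w t|%:R / n%:R.

Definition stop_date (i : 'I_n) (w : Omega) : \bar R :=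
  ereal_inf [set t%:E | t in [set t | 0 <= t /\ i \in stop w t]].

Lemma signal_path_le w a b i : 0 <= a -> a <= b ->
  signal_path w a i <= signal_path w b i.
Proof. by move=> a0 ab; apply: (signal_increasing (Y_signal i)). Qed.

(** Right-continuity makes the infimum in [stop_date] attained. *)
Lemma stop_date_le i w t : 0 <= t -> (stop_date i w <= t%:E)%E = (i \in stop w t).
Proof.
move=> t0; apply/idP/idP => [tt|it]; last by apply: ereal_inf_lbound; exists t.
have cont k : signal_path w a k @[a --> t^'+] --> signal_path w t k.
  exact: (signal_right_continuous (Y_signal k)).
have nst : \forall a \near t^'+, stop w a = stop w t.
  by apply: stopped_right_continuous => // *; exact: signal_path_le.
near (t^'+) => a.
have sa : stop w a = stop w t by near: a.
have ta : t < a by near: a; exact: nbhs_right_gt.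
have /ereal_inf_lt[_ [b [b0 ib] <-]] : (stop_date i w < a%:E)%E.
  by apply: le_lt_trans tt _; rewrite lte_fin.
rewrite lte_fin -sa => ba; apply: fintype.subsetP ib.
by apply: stopped_le (ltW ba) => //; exact: signal_path_le.
Unshelve. all: by end_near. Qed.

Lemma measurable_keen (u a t : R) (i : 'I_n) : 0 <= a -> a <= t ->
  G t [set w | i \in keen r c u (signal_path w a)].
Proof.
move=> a0 at_; apply: (filtration_increasing hG a0 at_).
rewrite (_ : [set w | _] = Y i a @^-1` [set` `[r - c * u, +oo[]).
  apply: (progressively_measurable_adapted _ _ hG _ _ a0) => //.
  exact: (signal_progressive (Y_signal i)).
by apply/seteqP; split=> w /=; rewrite in_itv/= andbT lerBlDr inE.
Qed.

Lemma measurable_stop t (Q : {set 'I_n} -> Prop) : 0 <= t ->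
  G t [set w | Q (stop w t)].
Proof.
move=> t0.
(* For a push after t the event is empty: its signals are not yet in G t. *)
pose b (k : 'I_n * {set 'I_n} + J * 'I_n) (w : Omega) : bool := match k with
  | inl (i, A) => i \in best_reply r c (signal_path w t) A
  | inr (j, i) => (s j <= t) && (i \in keen r c (v j) (signal_path w (s j)))
  end.
apply: (finite_information _ _ b).
- exact: (filtration_sigma_algebra hG).
- move=> [[i A]|[j i]] /=.
    have := measurable_keen (others A i) t t i t0 (lexx t).
    congr (G t _); apply/seteqP; split=> w /=; by rewrite !inE.
  have [st|st] := leP (s j) t; first exact: measurable_keen.
  rewrite (_ : [set w | _] = set0) ?predeqE//.
  by have [] := filtration_sigma_algebra hG t0.
- move=> w w' bb /=; rewrite /stop (_ : stopped r c s v (signal_path w) t =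
    stopped r c s v (signal_path w') t)//.
  apply: eq_stopped => //.
    by move=> A; apply/finset.setP => i; apply: (bb (inl (i, A))).
  by move=> j st; apply/finset.setP => i; have := bb (inr (j, i)); rewrite /= st.
Qed.

(** Since [stop w t] is a fixed point, belonging to it at time t means exactly
    that the intensity at t is at least r; the stopping dates are thus the
    hitting times they generate. *)
Lemma pushed_equilibrium : nplayer_equilibrium G r c Y n stopped_share.
Proof.
have stE t w : 0 <= t -> [set j : 'I_n | (stop_date j w <= t%:E)%E]%SET = stop w t.
  by move=> t0; apply/finset.setP => j; rewrite inE stop_date_le.
split.
  move=> t t0 B mB.
  exact: (measurable_stop t (fun S => B (#|S|%:R / n%:R))).
exists stop_date; split; last by move=> t w t0; rewrite /stopped_fraction stE.
move=> i; split; first split.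
- by move=> w; apply: le_ereal_inf_tmp => _ [t [t0 _] <-]; rewrite lee_fin.
- move=> t t0.
  rewrite (_ : [set w | _] = [set w | i \in stop w t]).
    exact: (measurable_stop t (fun S => i \in S)).
  by apply/seteqP; split=> w /=; rewrite stop_date_le.
have intensityE t w : 0 <= t ->
    (r <= nplayer_intensity c Y stop_date i t w) = (i \in stop w t).
  move=> t0; rewrite -[X in _ = (i \in pred_of_set X)]stopped_fixed//; last first.
    exact: signal_path_le.
  rewrite inE /nplayer_intensity /others_stopped_fraction /others.
  congr (_ <= _ + c * (#|pred_of_set _|%:R / _)).
  by apply/finset.setP => j; rewrite !inE stop_date_le.
move=> w; congr ereal_inf; congr (image _ _).
by apply/seteqP; split=> t /= [t0]; rewrite intensityE.
Qed.

End PushedEquilibrium.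

(** * Large populations *)

Section SignalLaw.
Context {d : measure_display} {T : measurableType d} {R : realType}.
Variable P : probability T R.

(** Continuity of the c.d.f. excludes an atom at a, so that the strict and weak
    inequalities have the same probability. *)
Lemma probability_ge_cdf (X : T -> R) (F : R -> R) (a : R) :
  measurable_fun setT X -> has_cdf P X F -> continuous F ->
  P [set w | a <= X w] = (1 - F a)%:E.
Proof.
move=> mX FX cF.
have mI (A : set R) : measurable A -> measurable (X @^-1` A).
  by move=> mA; rewrite -[_ @^-1` _]setTI; exact: mX.
have mlt : measurable [set w | X w < a].
  rewrite (_ : [set w | _] = X @^-1` [set` `]-oo, a[]).
    by apply: mI; exact: measurable_itv.
  by apply/seteqP; split=> w /=; rewrite in_itv.
have mle b : measurable [set w | X w <= b].
  rewrite (_ : [set w | _] = X @^-1` [set` `]-oo, b]]).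
    by apply: mI; exact: measurable_itv.
  by apply/seteqP; split=> w /=; rewrite in_itv.
have Plt : P [set w | X w < a] = (F a)%:E.
  apply/eqP; rewrite eq_le; apply/andP; split.
    by rewrite -FX; apply: le_measure; rewrite ?inE// => w /= /ltW.
  rewrite leNgt; apply/negP => lta.
  have [p Pp] : exists p, P [set w | X w < a] = p%:E.
    by exists (fine (P [set w | X w < a])); rewrite fineK// fin_num_measure.
  rewrite Pp lte_fin in lta.
  have cFl : F x @[x --> a^'-] --> F a by apply: cvg_at_left_filter; exact: cF.
  near (a^'-) => x.
  have xa : x < a by near: x; exact: nbhs_left_lt.
  have : p < F x by near: x; exact: (cvgr_gt _ cFl).
  rewrite ltNge -lee_fin -Pp -FX => /negP; apply.
  by apply: le_measure; rewrite ?inE// => w /= /le_lt_trans; apply.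
rewrite (_ : [set w | a <= X w] = ~` [set w | X w < a]).
  by rewrite probability_setC// Plt.
by apply/seteqP; split=> w /=; rewrite leNgt => /negP.
Unshelve. all: by end_near. Qed.

End SignalLaw.

Section KeenLaw.
Context {d : measure_display} {Omega : measurableType d} {R : realType}.
Variables (P : probability Omega R) (G : R -> set (set Omega)) (r c : R).
Hypothesis hG : right_continuous_filtration G.
Variables (F : R -> R -> R) (Y : nat -> R -> Omega -> R).
Hypothesis hF : forall t, 0 <= t -> continuous (F t).
Hypothesis hY : nplayer_signals P G F Y.
Variables (t u : R).
Hypothesis t_ge0 : 0 <= t.

Let b (i : nat) (w : Omega) : bool := r <= Y i t w + c * u.

Lemma measurable_signal i : measurable_fun setT (Y i t).
Proof.
move=> _ B mB; rewrite setTI; apply: (filtration_measurable hG t_ge0).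
apply: (progressively_measurable_adapted _ _ hG _ _ t_ge0) => //.
exact: (signal_progressive (nplayer_signal hY i)).
Qed.

Let bE i : [set w | b i w] = Y i t @^-1` [set` `[r - c * u, +oo[].
Proof. by apply/seteqP; split=> w /=; rewrite in_itv/= andbT lerBlDr. Qed.

Let mb i : measurable [set w | b i w].
Proof.
rewrite bE -[X in measurable X]setTI.
by apply: measurable_signal => //; exact: measurable_itv.
Qed.

Let Pb i : P [set w | b i w] = (1 - F t (r - c * u))%:E.
Proof.
rewrite -(probability_ge_cdf P _ _ _ (measurable_signal i)
  (nplayer_cdf hY i t_ge0) (hF _ t_ge0)).
by congr (P _); apply/seteqP; split=> w /=; rewrite lerBlDr.
Qed.

Let Pbb i j : i != j -> P ([set w | b i w] `&` [set w | b j w]) =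
  ((1 - F t (r - c * u)) * (1 - F t (r - c * u)))%:E.
Proof.
move=> ij; rewrite EFinM -{1}(Pb i) -(Pb j) !bE.
by apply: (nplayer_independent hY ij t_ge0); exact: measurable_itv.
Qed.

Definition keen_count (n : nat) (w : Omega) : R :=
  #|keen r c u (fun i : 'I_n => Y i t w)|%:R.

Lemma keen_countE n w : keen_count n w = occurrences b n w.
Proof.
rewrite /keen_count /occurrences -natr_sum; congr (_%:R).
by rewrite -sum1dep_card big_mkcond.
Qed.

Lemma measurable_keen_count n : measurable_fun setT (keen_count n).
Proof.
by rewrite (funext (keen_countE n)); apply: measurable_occurrences.
Qed.

Lemma measurable_count_lt n a : measurable [set w | keen_count n w < a].
Proof.
rewrite (_ : [set w | _] = setT `&` keen_count n @^-1` [set` `]-oo, a[]).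
  by apply: measurable_keen_count => //; exact: measurable_itv.
by apply/seteqP; split=> w /=; rewrite in_itv/= => // -[].
Qed.

Lemma measurable_count_gt n a : measurable [set w | a < keen_count n w].
Proof.
rewrite (_ : [set w | _] = setT `&` keen_count n @^-1` [set` `]a, +oo[]).
  by apply: measurable_keen_count => //; exact: measurable_itv.
by apply/seteqP; split=> w /=; rewrite in_itv/= andbT => // -[].
Qed.

Lemma keen_count_law e : 0 < e ->
  P [set w | e * n%:R <= `|keen_count n w - n%:R * (1 - F t (r - c * u))|]
    @[n --> \oo] --> 0%E.
Proof.
move=> e0; under eq_fun do under eq_set do rewrite keen_countE.
exact: weak_law.
Qed.

(** A push at a level below the curve 1 - F_t(r - c u) succeeds in a large
    population. *)
Lemma keen_count_low : u + F t (r - c * u) < 1 ->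
  P [set w | keen_count n w < u * n%:R + 1] @[n --> \oo] --> 0%E.
Proof.
move=> uF; set e := (1 - F t (r - c * u) - u) / 2.
have e0 : 0 < e by rewrite /e; lra.
apply: (squeeze_cvge _ (cvg_cst 0%E) (keen_count_law e e0)).
near=> n; rewrite measure_ge0/=; apply: le_measure; rewrite ?inE.
- exact: measurable_count_lt.
- rewrite -[X in measurable X]setTI; apply: measurable_fun_le => //.
  apply: measurableT_comp => //; apply: measurable_funB => //.
  exact: measurable_keen_count.
move=> w /= kw.
(* Half of the gap absorbs the additional player required for the push. *)
have en : 1 <= e * n%:R.
  rewrite mulrC -ler_pdivrMr// mul1r; near: n; exact: nbhs_infty_ger.
rewrite ler0_norm; rewrite /e in en *; nra.
Unshelve. all: by end_near. Qed.

(** A level above the curve 1 - F_t(r - c u) closes itself in a large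
    population. *)
Lemma keen_count_high : 1 < u + F t (r - c * u) ->
  P [set w | u * n%:R < keen_count n w] @[n --> \oo] --> 0%E.
Proof.
move=> uF; set e := u - (1 - F t (r - c * u)).
have e0 : 0 < e by rewrite /e; lra.
apply: (squeeze_cvge _ (cvg_cst 0%E) (keen_count_law e e0)).
near=> n; rewrite measure_ge0/=; apply: le_measure; rewrite ?inE.
- exact: measurable_count_gt.
- rewrite -[X in measurable X]setTI; apply: measurable_fun_le => //.
  apply: measurableT_comp => //; apply: measurable_funB => //.
  exact: measurable_keen_count.
move=> w /= kw; apply: le_trans (ler_norm _); rewrite /e; nra.
Unshelve. all: by end_near. Qed.

End KeenLaw.

(** * Mean field data and conclusion *)

(** Two dates only involve two almost sure events, so that a single scenario
    realizes rho at both of them, as the mass of two nested sets. *)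
Lemma mean_field_equilibrium_le {dI dO : measure_display}
    {I : measurableType dI} {Omega : measurableType dO} {R : realType}
    (lambda : probability I R) (P : probability Omega R) (r c : R)
    (Y : I -> R -> Omega -> R) (rho : R -> R) :
  mean_field_equilibrium lambda P r c Y rho ->
  forall a b, 0 <= a -> a <= b -> rho a <= rho b.
Proof.
move=> [_ [tau [_ tauP]]] a b a0 ab.
have P_proper : ProperFilter (almost_everywhere P).
  apply: ae_properfilter_algebraOfSetsType.
  by rewrite (_ : _ [set: _] = 1%E) ?lte01//; exact: probability_setT.
have [w [[ma la] [mb lb]]] :=
  @filter_ex _ _ P_proper _ (filterI (tauP a a0) (tauP b (le_trans a0 ab))).
rewrite -lee_fin -la -lb; apply: le_measure; rewrite ?inE// => i /=.
by move=> /le_trans; apply; rewrite lee_fin.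
Qed.

(** Pick a point of D in each ball of rational center and radius 1/(k+1) that
    meets D. *)
Lemma dense_in_Rplus_sequence {R : realType} (D : set R) :
  dense_in_Rplus D -> exists t_ : nat -> R,
    (forall k, D (t_ k)) /\ dense_in_Rplus (range t_).
Proof.
move=> [D0 dD].
have [x0 Dx0] : exists x, D x.
  by have [x [Dx _]] := dD 0 (lexx 0) setT filterT; exists x.
have /choice[f fP] : forall p : rat * nat, exists y, D y /\
    ((exists x, D x /\ `|x - ratr p.1| < p.2.+1%:R^-1) ->
      `|y - ratr p.1| < p.2.+1%:R^-1).
  move=> p; have [[x [Dx xp]]|nx] :=
    pselect (exists x, D x /\ `|x - ratr p.1| < p.2.+1%:R^-1).
    by exists x.
  by exists x0.
exists (fun k => f (odflt (0%Q, 0%N) (unpickle k))).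
split; first by move=> k; have [] := fP (odflt (0%Q, 0%N) (unpickle k)).
split.
  move=> _ [k _ <-]; apply: D0.
  by have [] := fP (odflt (0%Q, 0%N) (unpickle k)).
move=> x x_ge0 U /nbhs_ballP[e/= e0 eU].
have e30 : 0 < e / 3 by rewrite divr_gt0.
have [k ke] : exists k : nat, k.+1%:R^-1 < e / 3 :> R.
  near \oo => k; exists k; near: k.
  exact: (cvgr_lt _ (@cvg_harmonic R)).
have k0 : 0 < k.+1%:R^-1 :> R by rewrite invr_gt0.
have [y [Dy xy]] := dD x x_ge0 (ball x (e / 3)) (nbhsx_ballx _ _ e30).
have yk : y < y + k.+1%:R^-1 by rewrite ltrDl.
have [q] := rat_in_itvoo yk; rewrite in_itv/= => /andP[yq qy].
have yqk : `|y - ratr q| < k.+1%:R^-1.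
  by rewrite distrC ger0_norm ?subr_ge0 ?ltrBlDl ?(ltW yq).
have [_ /(_ (ex_intro _ y (conj Dy yqk))) fq] := fP (q, k).
exists (f (q, k)); split; first by exists (pickle (q, k)) => //; rewrite pickleK.
apply: eU; rewrite /ball/=; rewrite /ball/= in xy.
have -> : x - f (q, k) = (x - y) + (y - ratr q) + (ratr q - f (q, k)).
  by rewrite !addrA !addrNK.
apply: le_lt_trans (ler_normD _ _) _; rewrite (_ : e = e / 3 + e / 3 + e / 3).
  rewrite ltrD//; last by rewrite distrC (lt_trans fq).
  by rewrite (le_lt_trans (ler_normD _ _))// ltrD// (lt_trans yqk).
by field.
Unshelve. all: by end_near. Qed.

Theorem theorem6p1 (R : realType)
  (dO dI : measure_display) (Omega : measurableType dO) (I : measurableType dI)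
  (P : probability Omega R) (G : R -> set (set Omega))
  (hG : right_continuous_filtration G)
  (r c : R) (hc : 0 < c)
  (F : R -> R -> R) (hF : forall t : R, 0 <= t -> continuous (F t))
  (E : Omega -> R) (hE : independent_exponential P G E)
  (Yn : nat -> R -> Omega -> R) (hYn : nplayer_signals P G F Yn)
  (hn : nplayer_standing_assumptions P G r c Yn E)
  (lambda : probability I R) (hlambda : atomless lambda)
  (Sigma : set (set (I * Omega)))
  (mu : probability (g_sigma_algebraType Sigma) R)
  (hmu : fubini_extension lambda P mu)
  (Y : I -> R -> Omega -> R) (hY : mfg_signals lambda P G F Y Sigma)
  (rho : R -> R) (hrho : mean_field_equilibrium lambda P r c Y rho)
  (hmfg : mfg_standing_assumptions lambda P G r c Y E rho)
  (D : set R) (hD : dense_in_Rplus D)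
  (htrans : forall t, D t -> increasing_transversal r c (F t) (rho t)) :
  exists rho_ : nat -> R -> Omega -> R,
    (forall n, (0 < n)%N -> nplayer_equilibrium G r c Yn n (rho_ n)) /\
    fatou_cvg_in_probability P rho_ rho.
Proof.
have rho_le : forall a b, 0 <= a -> a <= b -> rho a <= rho b.
  exact: (mean_field_equilibrium_le _ _ _ _ _ _ hrho).
have [t_ [Dt dt]] := dense_in_Rplus_sequence D hD.
have t_ge0 k : 0 <= t_ k by exact: hD.1.
have /choice[v vP] : forall p : nat * nat, exists v : R,
    rho (t_ p.1) - p.2.+1%:R^-1 < v < rho (t_ p.1) /\
    v + F (t_ p.1) (r - c * v) < 1.
  move=> [k m] /=; have [_ _ low _] := htrans _ (Dt k).
  by apply: low; rewrite invr_gt0.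
pose s n (p : 'I_n * 'I_n) : R := t_ p.1.
pose u n (p : 'I_n * 'I_n) : R := v (p.1 : nat, p.2 : nat).
exists (fun n => stopped_share r c Yn n _ (s n) (u n)); split.
  move=> n _; apply: pushed_equilibrium => //.
    by move=> i; exact: (nplayer_signal hYn i).
  by move=> p; exact: t_ge0.
exists (range t_); split=> // _ [k _ <-] e e0.
(* The level v (k, m) is the lower barrier and h the upper one. *)
have [m me] : exists m : nat, m.+1%:R^-1 < e :> R.
  near \oo => m; exists m; near: m.
  exact: (cvgr_lt _ (@cvg_harmonic R)).
have [_ _ _ /(_ e e0)[h [/andP[rh he] hF1]]] := htrans _ (Dt k).
have [/andP[vr1 vr2] vF1] := vP (k, m).
have low := keen_count_low P G r c hG F Yn hF hYn (t_ k) (v (k, m)) (t_ge0 k) vF1.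
have high := keen_count_high P G r c hG F Yn hF hYn (t_ k) h (t_ge0 k) hF1.
have lim0 := cvgeD (isT : ((0 : \bar R) +? 0)%E) low high.
rewrite adde0 in lim0.
apply: (squeeze_cvge _ (cvg_cst 0%E) (lim0 _)).
near=> n; rewrite measure_ge0/=.
have kn : (k < n)%N by near: n; exact: nbhs_infty_gt.
have mn : (m < n)%N by near: n; exact: nbhs_infty_gt.
have n0 : (0 < n)%N by exact: leq_ltn_trans kn.
have ml := measurable_count_lt P G r c hG F Yn hYn (t_ k) (v (k, m)) (t_ge0 k)
  n (v (k, m) * n%:R + 1).
have mh := measurable_count_gt P G r c hG F Yn hYn (t_ k) h (t_ge0 k)
  n (h * n%:R).
apply: le_trans (measureU2 _ ml mh); apply: le_measure; rewrite ?inE.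
- apply: (filtration_measurable hG (t_ge0 k)).
  have sig i : signal_process G (Yn i) := nplayer_signal hYn i.
  exact: (measurable_stop G r c hG Yn sig n _ (s n) (u n)
    (fun p => t_ge0 p.1) (t_ k)
    (fun S => e <= `|#|S|%:R / n%:R - rho (t_ k)|) (t_ge0 k)).
- exact: measurableU.
move=> w /= ew; apply: contrapT => /not_orP[/negP + /negP].
rewrite -!leNgt => wl wh.
have rho_n_low : v (k, m) <= stopped_share r c Yn n _ (s n) (u n) (t_ k) w.
  apply: (@stopped_ge _ _ _ _ _ hc _ _ _ _ (Ordinal kn, Ordinal mn)) => //.
  by rewrite /pushing lexx.
have rho_n_high : stopped_share r c Yn n _ (s n) (u n) (t_ k) w <= h.
  apply: stopped_le_level => //.
  - by move=> p; exact: t_ge0.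
  - by move=> a b i a0 ab; apply: (signal_increasing (nplayer_signal hYn i)).
  - move=> p tp; apply: ltW; apply: lt_trans rh.
    have [/andP[_ vr] _] := vP (p.1 : nat, p.2 : nat).
    by apply: (lt_le_trans vr); apply: rho_le.
move: ew; rewrite leNgt ltr_norml => /negP; apply.
apply/andP; split; last by rewrite ltrBlDl; exact: le_lt_trans he.
rewrite ltrBrDl; apply: lt_le_trans rho_n_low; apply: lt_trans vr1.
by rewrite ltrD2l ltrN2.
Unshelve. all: by end_near. Qed.
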